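(* Let $X$ be a real Banach space, $X\neq\{0\}$. If $X$ has the strong diameter 2 property (SD2P), then the bidual $X^{**}$ is neither strictly convex nor smooth.
   Context: $B_X$ and $S_X$ denote the closed unit ball and the unit sphere of $X$; $X^*$ is the topological dual. A slice of $B_X$ is a set of the form $S(x^*,\varepsilon)=\{x\in B_X : x^*(x)>1-\varepsilon\}$ with $x^*\in S_{X^*}$ and $\varepsilon>0$. $X$ has the strong diameter 2 property (SD2P) if every finite convex combination of slices of $B_X$, i.e. every set $\sum_{i=1}^n\lambda_i S_i=\{\sum_{i=1}^n\lambda_i x_i : x_i\in S_i\}$ with $S_i$ slices of $B_X$, $\lambda_i\ge 0$, $\sum_{i=1}^n\lambda_i=1$, has diameter 2. A Banach space $Z$ is strictly convex if $\|\frac{x+y}{2}\|<1$ whenever $x\ne y$ are points of $S_Z$. $Z$ is smooth if for every $x\in S_Z$ there is exactly one $x^*\in S_{Z^*}$ with $x^*(x)=1$. *)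

(* Defs.v *)
From HB Require Import structures.
From mathcomp Require Import all_boot all_order all_algebra.
From mathcomp Require Import all_classical all_reals all_analysis.

Set Implicit Arguments.
Unset Strict Implicit.
Unset Printing Implicit Defensive.

Import Order.TTheory GRing.Theory Num.Theory.
Import numFieldNormedType.Exports.

Local Open Scope classical_set_scope.
Local Open Scope ring_scope.

Definition unit_ball (R : realType) (X : normedModType R) : set X :=
  [set x | `|x| <= 1].

Definition unit_sphere (R : realType) (X : normedModType R) : set X :=
  [set x | `|x| = 1].

Section dual.
Context (R : realType) (X : normedModType R).

Definition continuous_linear : {pred X -> R^o} :=
  mem [set f : X -> R^o | linear f /\ continuous f].

Record dual := Dual {
  dual_val :> X -> R^o ;
  _ : dual_val \in continuous_linear }.

HB.instance Definition _ := [isSub for dual_val].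
HB.instance Definition _ := [Choice of dual by <:].

Lemma continuous_linear_submod_closed : submod_closed continuous_linear.
Proof.
split.
  by rewrite inE; split; [move=> a x y; rewrite scaler0 addr0 | exact: cst_continuous].
move=> a f g; rewrite !inE => -[lf cf] [lg cg]; split.
  move=> b x y; rewrite !fctE lf lg !scalerDr !scalerA (mulrC a b).
  by rewrite !addrA; congr (_ + _); rewrite -!addrA; congr (_ + _); rewrite addrC.
move=> x; apply: continuousD; last exact: cg.
by apply: continuousZl_tmp; exact: cf.
Qed.

HB.instance Definition _ :=
  GRing.isSubmodClosed.Build R (X -> R^o) continuous_linear
  continuous_linear_submod_closed.

HB.instance Definition _ := [SubChoice_isSubLmodule of dual by <:].

Lemma dual_linear (f : dual) : linear f.
Proof. by case: f => f /= /set_mem[]. Qed.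

Lemma dual_continuous (f : dual) : continuous f.
Proof. by case: f => f /= /set_mem[]. Qed.

HB.instance Definition _ (f : dual) :=
  GRing.isLinear.Build R X R^o _ (dual_val f) (dual_linear f).

Definition dual_norm (f : dual) : R := sup [set `|f x| | x in @unit_ball R X].

Lemma dual_norm_has_sup (f : dual) : has_sup [set `|f x| | x in @unit_ball R X].
Proof.
split; first by exists `|f 0|; exists 0 => //; rewrite /unit_ball/= normr0.
have /bounded_funP/(_ 1)[M fM] : bounded_near f (nbhs (0 : X)).
  exact/linear_bounded_continuous/dual_continuous.
by exists M => _ [x x1 <-]; exact: fM.
Qed.

Lemma dual_norm_ub (f : dual) (x : X) : `|x| <= 1 -> `|f x| <= dual_norm f.
Proof.
by move=> x1; apply: ub_le_sup; [exact: (dual_norm_has_sup f).2 | exists x].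
Qed.

Lemma dual_norm_le (f : dual) (M : R) :
  (forall x : X, `|x| <= 1 -> `|f x| <= M) -> dual_norm f <= M.
Proof.
move=> fM; apply: ge_sup; first exact: (dual_norm_has_sup f).1.
by move=> _ [x x1 <-]; exact: fM.
Qed.

Lemma dual_norm_ge0 (f : dual) : 0 <= dual_norm f.
Proof.
by apply: le_trans (dual_norm_ub f (_ : `|0| <= 1)); rewrite ?normr0.
Qed.

Lemma dual_addE (f g : dual) (x : X) : (f + g) x = f x + g x.
Proof. by []. Qed.

Lemma dual_scaleE (a : R) (f : dual) (x : X) : (a *: f) x = a * f x.
Proof. by []. Qed.

Lemma ler_dual_normD (f g : dual) :
  dual_norm (f + g) <= dual_norm f + dual_norm g.
Proof.
apply: dual_norm_le => x x1; rewrite dual_addE.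
by apply: le_trans (ler_normD _ _) _; apply: lerD; exact: dual_norm_ub.
Qed.

Lemma dual_normZ (a : R) (f : dual) : dual_norm (a *: f) = `|a| * dual_norm f.
Proof.
have leZ b h : dual_norm (b *: h) <= `|b| * dual_norm h.
  apply: dual_norm_le => x x1; rewrite dual_scaleE normrM.
  by apply: ler_wpM2l => //; exact: dual_norm_ub.
apply/eqP; rewrite eq_le leZ/=; have [->|a0] := eqVneq a 0.
  by rewrite normr0 mul0r dual_norm_ge0.
rewrite -ler_pdivlMl ?normr_gt0// -normfV.
by rewrite -{1}[f]scale1r -(mulVf a0) -scalerA; exact: leZ.
Qed.

Lemma dual_norm0_eq0 (f : dual) : dual_norm f = 0 -> f = 0.
Proof.
move=> f0; apply/val_inj/funext => x /=.
have [->|x0] := eqVneq x 0; first exact: (linear0 f).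
have : `|f (`|x|^-1 *: x)| <= 0.
  by rewrite -f0; apply: dual_norm_ub; rewrite normrZ normfV normr_id mulVf ?normr_eq0.
rewrite normr_le0 linearZ/= => /eqP/(congr1 ( *%R `|x|)).
by rewrite mulr0 -[_ *: _]/(_ * _) mulVKf ?normr_eq0.
Qed.

HB.instance Definition _ := @Lmodule_isNormed.Build R dual
  dual_norm ler_dual_normD dual_normZ dual_norm0_eq0.

Lemma dual_normE (f : dual) : `|f| = sup [set `|f x| | x in @unit_ball R X].
Proof. by []. Qed.

End dual.

Definition slice (R : realType) (X : normedModType R) (f : dual X) (e : R) :
    set X :=
  [set x | unit_ball x /\ f x > 1 - e].

Definition is_slice (R : realType) (X : normedModType R) (A : set X) : Prop :=
  exists f : dual X, exists e : R, [/\ unit_sphere f, 0 < e & A = slice f e].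

Definition diameter (R : realType) (X : normedModType R) (A : set X) : \bar R :=
  ereal_sup [set `|x - y|%:E | x in A & y in A].

Definition SD2P (R : realType) (X : normedModType R) : Prop :=
  forall (n : nat) (lambda : 'I_n -> R) (S : 'I_n -> set X),
    (forall i, is_slice (S i)) -> (forall i, 0 <= lambda i) ->
    \sum_(i < n) lambda i = 1 ->
    diameter [set \sum_(i < n) lambda i *: x i |
                x in [set x : 'I_n -> X | forall i, S i (x i)]] = 2%:E.

Definition strictly_convex (R : realType) (Z : normedModType R) : Prop :=
  forall x y : Z, unit_sphere x -> unit_sphere y -> x <> y ->
    `|2^-1 *: (x + y)| < 1.

Definition smooth (R : realType) (Z : normedModType R) : Prop :=
  forall x : Z, unit_sphere x ->
    exists! f : dual Z, unit_sphere f /\ f x = 1.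

(* Main.v *)
(** SD2P makes the dual [X^*] octahedral: given [g_1, ..., g_n] in [X^*], apply
SD2P to the average of slices on which the [g_i] are almost norming; two points
of this average at distance almost 2 are separated by a functional [f] that is
almost 1 on a point of each slice, whence [|g_i + f| >= |g_i| + 1 - d].  Finite
nets extend this to finite-dimensional subspaces, and an induction produces
[f_i] in the unit ball of [X^*] with
[sum_i (1 - 2^-i) |a_i| <= |sum_i a_i f_i|] (an asymptotically isometric copy
of l_1).  By Hahn-Banach there are [F], [G] in the unit ball of [X^**] with
[F f_i = 1 - 2^-i] and [G f_i = (-1)^i (1 - 2^-i)].  Testing on even and odd
indices yields [|a F + b G| >= |a + b|] and [|a F + b G| >= |a - b|]: the first
bound with [a = b = 1] contradicts strict convexity, and the two bounds give
functionals on [X^**] norming [F] with values 1 and -1 at [G]. *)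

Require Import Defs.
From HB Require Import structures.
From mathcomp Require Import all_boot all_order all_algebra.
From mathcomp Require Import all_classical all_reals all_analysis.
From mathcomp Require Import ring lra.

Set Implicit Arguments.
Unset Strict Implicit.
Unset Printing Implicit Defensive.

Import Order.TTheory GRing.Theory Num.Theory.
Import numFieldNormedType.Exports.

Local Open Scope classical_set_scope.
Local Open Scope ring_scope.

(** * Sublinear functionals and the Hahn-Banach theorem *)

(* For [a > 0] the inequality, applied also to [a^-1], is an equality. *)
Definition sublinear (R : realType) (V : lmodType R) (p : V -> R) :=
  (forall x y, p (x + y) <= p x + p y) /\
  (forall a x, 0 <= a -> p (a *: x) <= a * p x).

Lemma sublinear0 (R : realType) (V : lmodType R) (p : V -> R) :
  sublinear p -> p 0 = 0.
Proof.
move=> [pD pZ]; apply/eqP; rewrite eq_le.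
have := pZ 0 0 (lexx _); rewrite scaler0 mul0r => -> /=.
by have := pD 0 0; rewrite addr0 lerDl.
Qed.

Lemma sublinearN (R : realType) (V : lmodType R) (p : V -> R) x :
  sublinear p -> - p (- x) <= p x.
Proof.
move=> sp; rewrite -subr_ge0 opprK -(sublinear0 sp) -(subrr x).
exact: sp.1.
Qed.

Lemma sublinearZ (R : realType) (V : lmodType R) (p : V -> R) a x :
  sublinear p -> 0 <= a -> p (a *: x) = a * p x.
Proof.
move=> sp; rewrite le_eqVlt => /predU1P[<-|a0].
  by rewrite scale0r mul0r sublinear0.
have a0W := ltW a0.
apply/eqP; rewrite eq_le sp.2//= -ler_pdivlMl//.
rewrite -{1}[x]scale1r -(mulVf (lt0r_neq0 a0)) -scalerA.
by apply: sp.2; rewrite invr_ge0 ltW.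
Qed.

(** The bound [q] keeps the infima finite, and sums and nonnegative multiples pass to the infimum.
    It is applied to chains, to one-sided shifts along a vector and to an inf-convolution with the
    norm. *)
Lemma inf_sublinear (R : realType) (V : lmodType R) (A : V -> set R) (q : V -> R) :
  (forall x, A x !=set0) -> (forall x, lbound (A x) (q x)) ->
  (forall x y r s, A x r -> A y s -> exists2 t, A (x + y) t & t <= r + s) ->
  (forall a x r, 0 <= a -> A x r -> exists2 t, A (a *: x) t & t <= a * r) ->
  sublinear (fun x => inf (A x)).
Proof.
move=> A0 Aq AD AZ.
have hA x : has_inf (A x) by split => //; exists (q x); exact: Aq.
have Ale x r : A x r -> inf (A x) <= r.
  by move=> Axr; apply: ge_inf => //; exact: (hA x).2.
split=> [x y|a x a0].
  rewrite -lerBlDr; apply: lb_le_inf => // r Axr.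
  rewrite lerBlDr -lerBlDl; apply: lb_le_inf => // s Ays.
  rewrite lerBlDl; have [t At tle] := AD _ _ _ _ Axr Ays.
  exact: le_trans (Ale _ _ At) tle.
move: (a0); rewrite le_eqVlt => /predU1P[a00|agt0].
  have [r Axr] := A0 x; have [t At tle] := AZ _ _ _ a0 Axr.
  by apply: le_trans (Ale _ _ At) (le_trans tle _); rewrite -a00 !mul0r.
rewrite -ler_pdivrMl//; apply: lb_le_inf => // r Axr.
rewrite ler_pdivrMl//; have [t At tle] := AZ _ _ _ a0 Axr.
exact: le_trans (Ale _ _ At) tle.
Qed.

(** Zorn's lemma: a nonempty chain is bounded by its pointwise infimum, finite since every sublinear
    [t <= p] satisfies [t x >= - t (- x) >= - p (- x)]. *)
Lemma exists_minimal_sublinear (R : realType) (V : lmodType R) (p : V -> R) :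
  sublinear p -> exists q, [/\ sublinear q, forall x, q x <= p x &
    forall q', sublinear q' -> (forall x, q' x <= q x) -> forall x, q x <= q' x].
Proof.
move=> sp.
pose P (q : V -> R) := sublinear q /\ forall x, q x <= p x.
pose T := {q | P q}.
(* The pointwise order is reversed, so that maximal elements are minimal functionals. *)
pose le_T (s t : T) := `[< forall x, sval t x <= sval s x >].
have sT (t : T) : sublinear (sval t) by case: t => q [].
have Tp (t : T) x : sval t x <= p x by case: t => q [/= _ +]; exact.
pose p' : T := exist P p (conj sp (fun x => lexx (p x))).
have [|r s t /asboolP rs /asboolP st|A Atot|t tmin] := @ZL_preorder T p' le_T.
- by move=> t; apply/asboolP.
- by apply/asboolP => x; exact: le_trans (st x) (rs x).
- have [A0|/set0P[t0 At0]] := eqVneq A set0.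
    by exists p' => s; rewrite A0.
  pose B x : set R := [set sval t x | t in A].
  have lbB x : lbound (B x) (- p (- x)).
    move=> _ [t At <-]; apply: le_trans (sublinearN x (sT t)).
    by rewrite lerN2 Tp.
  have sB : sublinear (fun x => inf (B x)).
    apply: (@inf_sublinear _ _ _ (fun x => - p (- x))) => //.
    + by move=> x; exists (sval t0 x); exists t0.
    + move=> x y _ _ [s As <-] [t At <-].
      have [/asboolP st|/asboolP ts] := Atot _ _ As At.
      * exists (sval t (x + y)); first by exists t.
        by apply: le_trans ((sT t).1 _ _) _; rewrite lerD2r.
      * exists (sval s (x + y)); first by exists s.
        by apply: le_trans ((sT s).1 _ _) _; rewrite lerD2l.
    + move=> a x _ a0 [t At <-].
      by exists (sval t (a *: x)); [exists t|exact: (sT t).2].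
  have Ble t x : A t -> inf (B x) <= sval t x.
    by move=> At; apply: ge_inf; [exists (- p (- x))|exists t].
  have Bp x : inf (B x) <= p x by apply: le_trans (Ble t0 x At0) (Tp t0 x).
  exists (exist P _ (conj sB Bp)) => s As.
  by apply/asboolP => x; exact: Ble.
exists (sval t); split => // q' sq' q'le.
have q'p x : q' x <= p x by apply: le_trans (q'le x) (Tp t x).
by have /asboolP := tmin (exist P q' (conj sq' q'p)) (asboolT q'le).
Qed.

(** The infimum over [t >= 0] of [q (z + t *: y) - t * q y] is sublinear in [z] and at most [q z]
    (take [t = 0]), so minimality puts [q] below it. At [z = x], [t = 1] this reads
    [q x <= q (x + y) - q y]. *)
Lemma minimal_sublinear_additive (R : realType) (V : lmodType R) (q : V -> R) :
  sublinear q ->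
  (forall q', sublinear q' -> (forall x, q' x <= q x) -> forall x, q x <= q' x) ->
  forall x y, q (x + y) = q x + q y.
Proof.
move=> sq qmin x y.
pose B z : set R := [set q (z + t *: y) - t * q y | t in [set t | 0 <= t]].
have lbB z : lbound (B z) (- q (- z)).
  move=> _ [t t0 <-]; rewrite lerBrDr -(sublinearZ y sq t0) addrC lerBlDr.
  by rewrite -{1}(addrK z (t *: y)) (addrC (t *: y)); exact: sq.1.
have Bq z : B z (q z) by exists 0 => /=; rewrite ?scale0r ?addr0 ?mul0r ?subr0.
have Ble z r : B z r -> inf (B z) <= r.
  by move=> Bzr; apply: ge_inf => //; exists (- q (- z)).
have sB : sublinear (fun z => inf (B z)).
  apply: (@inf_sublinear _ _ _ (fun z => - q (- z))) => //.
  - by move=> z; exists (q z).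
  - move=> z w _ _ [s /= s0 <-] [t /= t0 <-].
    exists (q (z + w + (s + t) *: y) - (s + t) * q y).
      by exists (s + t) => //=; exact: addr_ge0.
    rewrite scalerDl addrACA mulrDl opprD [leRHS]addrACA lerD2r.
    exact: sq.1.
  - move=> a z _ a0 [t /= t0 <-].
    exists (q (a *: z + (a * t) *: y) - a * t * q y).
      by exists (a * t) => //=; exact: mulr_ge0.
    by rewrite -scalerA -scalerDr mulrBr mulrA lerD2r; exact: sq.2.
have qB := qmin _ sB (fun z => Ble z _ (Bq z)).
apply/eqP; rewrite eq_le sq.1 /= -lerBrDr.
apply: le_trans (qB x) (Ble _ _ _).
by exists 1 => /=; rewrite ?ler01 // scale1r mul1r.
Qed.

(** A minimal sublinear functional below [p] is already linear: additivity makes it odd, which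
    extends homogeneity to negative scalars. *)
Lemma Hahn_Banach (R : realType) (V : lmodType R) (p : V -> R) :
  sublinear p -> exists f : V -> R^o, linear f /\ forall x, f x <= p x.
Proof.
move=> sp; have [q [sq qp qmin]] := exists_minimal_sublinear sp.
exists q; split => // a x y.
have qD := minimal_sublinear_additive sq qmin.
have qN z : q (- z) = - q z.
  by apply/eqP; rewrite -addr_eq0 -qD addNr sublinear0.
rewrite qD; congr (_ + _); rewrite -[RHS]/(a * q x).
have [a0|/ltW a0] := lerP 0 a; first exact: sublinearZ.
rewrite -[a]opprK scaleNr qN (sublinearZ _ sq) ?oppr_ge0//.
by rewrite [in RHS]mulNr.
Qed.

(** * Norm-controlled extension and norming functionals *)

(* [D] is the graph of a linear functional on a subspace; that it is functional
   follows from the last hypothesis. *)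
Lemma Hahn_Banach_extension (R : realType) (Z : normedModType R)
    (D : Z -> R -> Prop) :
  D 0 0 -> (forall x y r s, D x r -> D y s -> D (x + y) (r + s)) ->
  (forall a x r, D x r -> D (a *: x) (a * r)) ->
  (forall x r, D x r -> r <= `|x|) ->
  exists F : dual Z, `|F| <= 1 /\ forall x r, D x r -> F x = r.
Proof.
move=> D0 DD DZ Dle.
have DN x r : D x r -> D (- x) (- r).
  by move=> /(DZ (-1)); rewrite scaleN1r mulN1r.
(* [inf (B z)] is at most [|z|] (take [x = 0]) and at most [r] wherever [D z r] (take [x = z]). A
   linear functional below it therefore has norm at most 1, and it agrees with [D] on applying the
   second bound to [z] and [- z]. *)
pose B z : set R := [set t | exists x r, D x r /\ t = `|z - x| + r].
have lbB z : lbound (B z) (- `|z|).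
  move=> _ [x [r [/DN/Dle + ->]]]; rewrite normrN => rx.
  by have := ler_normB z (z - x); rewrite subKr; lra.
have Ble z r : B z r -> inf (B z) <= r.
  by move=> Bzr; apply: ge_inf => //; exists (- `|z|).
have Bn z : B z `|z| by exists 0, 0; rewrite subr0 addr0.
have sB : sublinear (fun z => inf (B z)).
  apply: (@inf_sublinear _ _ _ (fun z => - `|z|)) => //.
  - by move=> z; exists `|z|.
  - move=> z w _ _ [x [r [Dxr ->]]] [y [s [Dys ->]]].
    exists (`|z + w - (x + y)| + (r + s)).
      by exists (x + y), (r + s); split => //; exact: DD.
    by rewrite [leRHS]addrACA lerD2r opprD addrACA ler_normD.
  - move=> a z _ a0 [x [r [Dxr ->]]].
    exists (`|a *: z - a *: x| + a * r).
      by exists (a *: x), (a * r); split => //; exact: DZ.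
    by rewrite -scalerBr normrZ ger0_norm// mulrDr.
have [f [lf fB]] := Hahn_Banach sB.
pose fL := GRing.isLinear.Build R Z R^o _ f lf.
pose f' : {linear Z -> R^o} := HB.pack f fL.
have fle z : f z <= `|z| by apply: le_trans (fB z) (Ble _ _ (Bn z)).
have fN z : f (- z) = - f z by exact: (linearN f').
have fnorm z : `|f z| <= `|z|.
  by rewrite ler_norml fle andbT lerNl -fN -[leRHS]normrN fle.
have cf : continuous f.
  apply: (@bounded_linear_continuous _ _ _ f').
  apply/bounded_funP => r; exists r => x xr; exact: le_trans (fnorm x) xr.
have fP : f \in @continuous_linear R Z by apply/mem_set.
exists (Dual fP); split; first by apply: dual_norm_le => x; exact: le_trans.
move=> x r Dxr /=.
have fler y s : D y s -> f y <= s.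
  move=> Dys; apply: le_trans (fB y) (Ble _ _ _).
  by exists y, s; rewrite subrr normr0 add0r.
apply/eqP; rewrite eq_le fler//= -lerN2 -fN.
by apply: fler; exact: DN.
Qed.

Lemma exists_norming (R : realType) (Z : normedModType R) (z : Z) :
  exists F : dual Z, `|F| <= 1 /\ F z = `|z|.
Proof.
have [||||F [F1 Fz]] := @Hahn_Banach_extension R Z
  (fun x r => exists a, x = a *: z /\ r = a * `|z|).
- by exists 0; rewrite scale0r mul0r.
- by move=> x y r s [a [-> ->]] [b [-> ->]]; exists (a + b); rewrite scalerDl mulrDl.
- by move=> a x r [b [-> ->]]; exists (a * b); rewrite scalerA mulrA.
- by move=> x r [a [-> ->]]; rewrite normrZ ler_wpM2r// ler_norm.
by exists F; split => //; apply: Fz; exists 1; rewrite scale1r mul1r.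
Qed.

Lemma dual_le_norm (R : realType) (Z : normedModType R) (F : dual Z) (z : Z) :
  `|z| <= 1 -> F z <= `|F|.
Proof. by move=> z1; apply: le_trans (ler_norm _) (dual_norm_ub F z1). Qed.

Lemma exists_unit_dual (R : realType) (Z : normedModType R) (z : Z) :
  z <> 0 -> exists F : dual Z, `|F| = 1.
Proof.
move=> /eqP z0; have [F [F1 Fz]] := exists_norming z.
exists F; apply/eqP; rewrite eq_le F1 /=.
have := @dual_le_norm _ _ F (`|z|^-1 *: z).
rewrite normrZ normfV normr_id mulVf ?normr_eq0// lexx => /(_ isT).
by rewrite linearZ/= Fz -[_ *: _]/(_ * _) mulVf ?normr_eq0.
Qed.

(** * From the strong diameter 2 property to octahedrality *)

(** For [g <> 0], normalise [g] and divide the width [d] by [|g|]. For [g = 0] any slice will do,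
    and one exists because [X] is nonzero. *)
Lemma exists_norming_slice (R : realType) (X : normedModType R) (g : dual X)
    (d : R) : (exists x : X, x <> 0) -> 0 < d ->
  exists S : set X, is_slice S /\
    forall x, S x -> `|x| <= 1 /\ `|g| - d <= g x.
Proof.
move=> [x0 /exists_unit_dual[f0 f01]] d0.
have [->|g0] := eqVneq g 0.
  exists (slice f0 1); split; first by exists f0, 1; split.
  move=> x [x1 _]; split=> //.
  by rewrite normr0 sub0r -[leRHS]/0 oppr_le0 ltW.
have ng : 0 < `|g| by rewrite normr_gt0.
exists (slice (`|g|^-1 *: g) (d / `|g|)); split.
  exists (`|g|^-1 *: g), (d / `|g|); split => //; last by rewrite divr_gt0.
  by rewrite /unit_sphere/= normrZ normfV normr_id mulVf// gt_eqF.
move=> x [x1]; rewrite dual_scaleE => gx; split => //.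
apply: ltW; rewrite -(ltr_pM2l (x := `|g|^-1)) ?invr_gt0//.
by rewrite mulrBr mulVf ?gt_eqF// (mulrC _ d).
Qed.

Lemma SD2P_octahedral (R : realType) (X : normedModType R) :
  (exists x : X, x <> 0) -> SD2P X ->
  forall (s : seq (dual X)) (d : R), 0 < d ->
  exists f : dual X, `|f| <= 1 /\ forall g, g \in s -> `|g| + 1 - d <= `|g + f|.
Proof.
move=> X0 sd s d d0.
have d20 : 0 < d / 2 by rewrite divr_gt0.
have /choice[S SP] (g : dual X) := exists_norming_slice g X0 d20.
case: s => [|g0 s'].
  by exists 0; split=> //; rewrite normr0.
set s := g0 :: s'; pose n := size s.
have n0 : 0 < n%:R :> R by rewrite ltr0n.
have := @sd n (fun=> n%:R^-1) (fun i => S s`_i).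
have -> : \sum_(i < n) n%:R^-1 = 1 :> R.
  by rewrite sumr_const card_ord -[LHS]mulr_natl mulfV// gt_eqF.
move=> /(_ (fun i => (SP _).1) _ erefl) => /(_ _)/wrap[i|].
  by rewrite invr_ge0 ltW.
set A := (X in diameter X) => dA.
(* Each slice has weight [n%:R^-1], so the defects [2 - (f (x i) - f (y i))] sum to less than
   [d / 2]. They are nonnegative, so each one is below [d / 2]. *)
have : ((2 - d / 2 / n%:R)%:E < diameter A)%E.
  by rewrite dA lte_fin ltrBlDr ltrDl divr_gt0.
move=> /ereal_sup_gt[_ [_ [x xS <-] [_ [y yS <-] <-]]]; rewrite lte_fin.
rewrite -sumrB.
have [f [f1 <-]] := exists_norming (\sum_(i < n) (n%:R^-1 *: x i - n%:R^-1 *: y i)).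
rewrite linear_sum/=.
have -> : \sum_(i < n) f (n%:R^-1 *: x i - n%:R^-1 *: y i) =
    2 - n%:R^-1 * \sum_(i < n) (2 - (f (x i) - f (y i))).
  rewrite sumrB sumr_const card_ord mulrBr -[2 *+ n]mulr_natl mulrA mulVf ?gt_eqF//.
  rewrite mul1r subKr mulr_sumr; apply: eq_bigr => i _.
  by rewrite -scalerBr linearZ linearB.
rewrite ltrD2l ltrN2 mulrC ltr_pM2r ?invr_gt0// => sumd.
have fle z : `|z| <= 1 -> `|f z| <= 1.
  by move=> z1; apply: le_trans (dual_norm_ub f z1) f1.
exists f; split => // g gs.
have ig : (index g s < n)%N by rewrite index_mem.
pose i := Ordinal ig.
have xy1 j : `|x j| <= 1 /\ `|y j| <= 1.
  by split; [exact: ((SP _).2 _ (xS j)).1|exact: ((SP _).2 _ (yS j)).1].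
have fxi : 1 - d / 2 <= f (x i).
  move: sumd; rewrite (bigD1 i)//=.
  have : 0 <= \sum_(j < n | j != i) (2 - (f (x j) - f (y j))).
    apply: sumr_ge0 => j _; have [/fle + /fle] := xy1 j.
    by rewrite !ler_norml; lra.
  by have [_ /fle] := xy1 i; rewrite ler_norml; lra.
have [x1] := (SP _).2 _ (xS i).
rewrite nth_index// => gx.
apply: le_trans (dual_le_norm (g + f) x1); rewrite dual_addE.
lra.
Qed.

(** * Finite nets and octahedrality over finite-dimensional spans *)

Lemma exists_segment_net (R : realType) (d : R) : 0 < d ->
  exists s : seq R, forall a, `|a| <= 1 -> exists2 b, b \in s & `|a - b| <= d.
Proof.
move=> d0; pose K := Num.truncn d^-1.
pose s0 := [seq k%:R * d | k <- iota 0 K.+1].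
have s0P a : 0 <= a <= 1 -> exists2 b, b \in s0 & `|a - b| <= d.
  move=> /andP[a0 a1]; pose k := Num.truncn (a / d).
  have ad0 : 0 <= a / d by rewrite divr_ge0// ltW.
  have /andP[ka ak] : k%:R <= a / d < k.+1%:R by exact: truncn_itv.
  exists (k%:R * d).
    apply/mapP; exists k => //; rewrite mem_iota/= add0n ltnS.
    apply: le_truncn; rewrite ler_pdivrMr// mulVf ?gt_eqF//.
  rewrite ler_pdivlMr// in ka; rewrite ltr_pdivrMr// -natr1 mulrDl mul1r in ak.
  by rewrite ler_norml; lra.
exists (s0 ++ [seq - b | b <- s0]) => a a1.
have [a0|a0] := lerP 0 a.
  have [|b bs ab] := s0P a; first by rewrite a0; move: a1; rewrite ler_norml; lra.
  by exists b => //; rewrite mem_cat bs.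
have [|b bs ab] := s0P (- a); first by move: a1; rewrite ler_norml; lra.
exists (- b); first by rewrite mem_cat orbC map_f.
by rewrite opprK -normrN opprD.
Qed.

Lemma exists_comb_net (R : realType) (Z : normedModType R) (f : nat -> Z)
    (n : nat) (d : R) : 0 < d ->
  exists s : seq Z, forall a : nat -> R,
    (forall i, (i < n)%N -> `|a i| <= 1) ->
    exists2 z, z \in s & `|\sum_(i < n) a i *: f i - z| <= d.
Proof.
elim: n d => [|n IHn] d d0.
  exists [:: 0] => a _; exists 0; first by rewrite inE.
  by rewrite big_ord0 subrr normr0 ltW.
have d20 : 0 < d / 2 by rewrite divr_gt0.
have [s sP] := IHn _ d20.
(* Half of the error goes to the first [n] terms and half to the last; the [+ 1] avoids dividing by
   zero when [f n = 0]. *)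
have fn0 : 0 < `|f n| + 1 by rewrite ltr_wpDl.
have [t tP] := exists_segment_net (divr_gt0 d20 fn0).
exists [seq z + b *: f n | z <- s, b <- t] => a a1.
have [z zs az] := sP a (fun i ilt => a1 i (ltnW ilt)).
have [b bt ab] := tP (a n) (a1 n (ltnSn n)).
exists (z + b *: f n); first exact: allpairs_f.
rewrite big_ord_recr/= opprD addrACA -scalerBl.
apply: le_trans (ler_normD _ _) _; rewrite normrZ (splitr d) lerD//.
move: ab; rewrite ler_pdivlMr//; apply: le_trans.
by rewrite ler_wpM2l// lerDl.
Qed.

(** The finite-set form of octahedrality, with [f] taken in the unit ball instead of the sphere. *)
Definition octahedral (R : realType) (Z : normedModType R) :=
  forall (s : seq Z) (d : R), 0 < d ->
  exists f : Z, `|f| <= 1 /\ forall g, g \in s -> `|g| + 1 - d <= `|g + f|.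

(** Octahedrality is applied to a finite net of the combinations with coefficients in [[-1, 1]];
    homogeneity then scales the error by the sum of the absolute values of the coefficients. *)
Lemma octahedral_step (R : realType) (Z : normedModType R) (f : nat -> Z)
    (n : nat) (d : R) : octahedral Z -> 0 < d ->
  exists g : Z, `|g| <= 1 /\ forall (a : nat -> R) (b : R),
    `|\sum_(i < n) a i *: f i| + `|b| - d * (\sum_(i < n) `|a i| + `|b|) <=
    `|\sum_(i < n) a i *: f i + b *: g|.
Proof.
move=> octZ d0; have d40 : 0 < d / 4 by rewrite divr_gt0.
have [s sP] := exists_comb_net f n d40.
have d20 : 0 < d / 2 by rewrite divr_gt0.
have [g [g1 gP]] := octZ s _ d20.
exists g; split => //.
(* The total loss is [d]: the net error [d / 4] is paid twice, and octahedrality costs [d / 2].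
   Replacing [g] by [b *: g] costs [1 - b], which turns the gain 1 into [b]. *)
have unit_case (a : nat -> R) (b : R) : (forall i, (i < n)%N -> `|a i| <= 1) ->
    0 <= b <= 1 -> `|\sum_(i < n) a i *: f i| + b - d <=
    `|\sum_(i < n) a i *: f i + b *: g|.
  move=> /sP[z zs]; set e := \sum_(i < n) _ => ez /andP[b0 b1].
  have zg := gP z zs.
  have h1 : `|z| >= `|e| - d / 4.
    by have := ler_normB e (e - z); rewrite subKr => h; have := ler_normD (e - z) z;
       rewrite subrK; lra.
  have h2 : `|z + g| <= `|e + g| + `|e - z|.
    by have := ler_normB (e + g) (e - z); rewrite opprB addrC addrA subrK.
  have h3 : `|e + g| <= `|e + b *: g| + (1 - b).
    have -> : e + g = e + b *: g + (1 - b) *: g.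
      by rewrite -addrA -scalerDl subrKC scale1r.
    apply: le_trans (ler_normD _ _) _; rewrite lerD2l normrZ ger0_norm ?subr_ge0//.
    by apply: ler_piMr => //; rewrite subr_ge0.
  lra.
move=> a b; set e := \sum_(i < n) a i *: f i.
have S0 : 0 <= \sum_(i < n) `|a i| by apply: sumr_ge0.
have [->|b0] := eqVneq b 0.
  rewrite normr0 scale0r !addr0 lerBlDr lerDl.
  by rewrite mulr_ge0 // ltW.
set T := \sum_(i < n) `|a i| + `|b|.
have nb0 : 0 < `|b| by rewrite normr_gt0.
have T0 : 0 < T by rewrite ltr_wpDl.
(* Dividing by [T] brings all coefficients into [[-1, 1]], and the sign makes that of [g]
   nonnegative. *)
pose t := Num.sg b / T.
have nt : `|t| = T^-1 by rewrite normrM normr_sg b0 mul1r normfV gtr0_norm.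
have ntZ (v : Z) : `|t *: v| = T^-1 * `|v| by rewrite normrZ -nt.
have tb : t * b = `|b| / T by rewrite mulrAC -normrEsg.
have Ee : \sum_(i < n) (t * a i) *: f i = t *: e.
  by rewrite scaler_sumr; apply: eq_bigr => i _; rewrite scalerA.
have := unit_case (fun i => t * a i) (t * b).
rewrite /= Ee -[(t * b) *: g]scalerA -scalerDr !ntZ tb => /(_ _)/wrap[i ilt|].
  rewrite normrM nt ler_pdivrMl// mulr1 /T (bigD1 (Ordinal ilt))//= -addrA lerDl.
  by rewrite addr_ge0// sumr_ge0.
move=> /(_ _)/wrap[|].
  by rewrite (divr_ge0 (ltW nb0) (ltW T0))/= ler_pdivrMr// mul1r lerDr.
rewrite -(ler_pM2l T0) mulrA mulfV ?gt_eqF// mul1r mulrBr mulrDr mulrA mulfV ?gt_eqF//.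
by rewrite mul1r (mulrC _ (_ / _)) divfK ?gt_eqF// (mulrC T).
Qed.

(** * An asymptotically isometric copy of l_1 *)

Lemma exists_asymptotic_l1 (R : realType) (Z : normedModType R) :
  octahedral Z -> exists f : nat -> Z, (forall i, `|f i| <= 1) /\
    forall n (a : nat -> R),
      \sum_(i < n) (1 - 2^-1 ^+ i) * `|a i| <= `|\sum_(i < n) a i *: f i|.
Proof.
move=> octZ; pose h n : R := 2^-1 ^+ n.
have h0 n : 0 < h n by rewrite exprn_gt0.
have hS n : h n.+1 = h n / 2 by rewrite /h exprSr.
have /choice[u uP] (p : nat * (nat -> Z)) :=
  octahedral_step p.2 p.1 octZ (h0 p.1.+2).
(* Course-of-values recursion: [l n] holds the first [n] vectors, with the default 0 beyond them,
   and [u (n, l n)] is the next vector. *)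
pose l := fix l n : nat -> Z :=
  if n is m.+1 then fun i => if i == m then u (m, l m) else l m i else fun=> 0.
pose f n := u (n, l n).
have lf n i : (i < n)%N -> l n i = f i.
  elim: n => //= n IHn; rewrite ltnS leq_eqVlt => /predU1P[->|ilt].
    by rewrite eqxx.
  by rewrite ltn_eqF// IHn.
exists f; split=> [i|]; first exact: (uP (i, l i)).1.
(* The extra weight [h n.+1] leaves room for the loss [d = h n.+2] incurred at
   step [n]. *)
suff inv n (a : nat -> R) :
    \sum_(i < n) (1 - h i + h n.+1) * `|a i| <= `|\sum_(i < n) a i *: f i|.
  move=> n a; apply: le_trans (inv n a); apply: ler_sum => i _.
  by rewrite ler_wpM2r// lerDl ltW.
elim: n => [|n IHn]; first by rewrite !big_ord0 normr0.
have := (uP (n, l n)).2 a (a n); rewrite -/(f n) /=.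
under eq_bigr do rewrite lf//.
rewrite [X in _ -> _ <= `|X|]big_ord_recr/=; apply: le_trans.
rewrite big_ord_recr/=.
have : \sum_(i < n) (1 - h i + h n.+2) * `|a i| =
    \sum_(i < n) (1 - h i + h n.+1) * `|a i| - h n.+2 * \sum_(i < n) `|a i|.
  rewrite mulr_sumr -sumrB; apply: eq_bigr => i _.
  by rewrite -mulrBl (hS n.+1); congr (_ * _); lra.
move=> ->.
(* Since [h n = 4 * h n.+2], the new coefficient can absorb both its own loss and the extra
   weight. *)
have : (1 - h n + h n.+2) * `|a n| <= `|a n| - h n.+2 * `|a n|.
  rewrite -{2}[`|a n|]mul1r -mulrBl ler_wpM2r// !hS.
  by have := h0 n; lra.
by have := IHn; lra.
Qed.

(** * A limit argument and functionals with prescribed values *)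

(** The hypothesis asks only for arbitrarily large [i], so that it can be met along even or along
    odd indices. *)
Lemma le_of_half_expr (R : realType) (x y : R) :
  (forall n, exists2 i, (n <= i)%N & (1 - 2^-1 ^+ i) * y <= x) -> y <= x.
Proof.
move=> H; rewrite leNgt; apply/negP => xy.
have [y0|y0] := lerP y 0.
  have [i _] := H 0; rewrite leNgt => /negP; apply.
  apply: lt_le_trans xy _; rewrite mulrBl mul1r lerBrDl -lerBrDr subrr.
  by rewrite mulr_ge0_le0// exprn_ge0// invr_ge0.
(* Once [2^-1 ^+ i < (y - x) / y], the number [(1 - 2^-1 ^+ i) * y] exceeds [x]. *)
have e0 : 0 < (y - x) / y by rewrite divr_gt0// subr_gt0.
have : (fun n => 2^-1 ^+ n : R) @ \oo --> (0 : R).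
  by apply: cvg_expr; rewrite ger0_norm ?invr_ge0// invf_lt1// ltr1n.
move=> /cvgrPdist_lt/(_ _ e0)[N _ NP].
have [i Ni] := H N; have := NP i Ni.
rewrite /= sub0r normrN ger0_norm ?exprn_ge0 ?invr_ge0//.
by rewrite ltr_pdivlMr// mulrBl mul1r; lra.
Qed.

(** The sum of the [a i * c i] is at most that of the [w i * |a i|], hence at most the norm of the
    combination of the [f i]; so the prescription on the span extends with norm at most 1. *)
Lemma exists_dual_prescribed (R : realType) (Z : normedModType R) (f : nat -> Z)
    (w c : nat -> R) : (forall n (a : nat -> R),
      \sum_(i < n) w i * `|a i| <= `|\sum_(i < n) a i *: f i|) ->
  (forall i, `|c i| <= w i) ->
  exists F : dual Z, `|F| <= 1 /\ forall i, F (f i) = c i.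
Proof.
move=> fw cw.
have widen (V : lmodType R) (g : nat -> V) (a : nat -> R) n m : (n <= m)%N ->
    \sum_(i < n) a i *: g i = \sum_(i < m) (if (i < n)%N then a i else 0) *: g i.
  move=> nm; rewrite (big_ord_widen _ (fun i => a i *: g i) nm) big_mkcond.
  by apply: eq_bigr => i _; case: ifP => // _; rewrite scale0r.
(* Combinations of different lengths are added after padding with zeros. The space [V] is general
   because this serves both the vectors [f i] and the scalars [c i]. *)
have combD (V : lmodType R) (g : nat -> V) (a b : nat -> R) n m :
    \sum_(i < n) a i *: g i + \sum_(i < m) b i *: g i =
    \sum_(i < maxn n m) ((if (i < n)%N then a i else 0) +
      (if (i < m)%N then b i else 0)) *: g i.
  rewrite (widen _ _ _ _ _ (leq_maxl n m)) (widen _ _ _ _ _ (leq_maxr n m)).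
  by rewrite -big_split; apply: eq_bigr => i _; rewrite scalerDl.
have [||||F [F1 Fc]] := @Hahn_Banach_extension R Z (fun x r => exists n (a : nat -> R),
  x = \sum_(i < n) a i *: f i /\ r = \sum_(i < n) a i *: (c i : R^o)).
- by exists 0, (fun=> 0); rewrite !big_ord0.
- move=> x y r s [n [a [-> ->]]] [m [b [-> ->]]].
  exists (maxn n m), (fun i => (if (i < n)%N then a i else 0) +
    (if (i < m)%N then b i else 0)).
  by split; exact: combD.
- move=> b x r [n [a [-> ->]]]; exists n, (fun i => b * a i).
  rewrite scaler_sumr mulr_sumr; split; apply: eq_bigr => i _.
    by rewrite scalerA.
  exact: mulrA.
- move=> x r [n [a [-> ->]]]; apply: le_trans (fw n a); apply: ler_sum => i _.
  apply: le_trans (ler_norm _) _.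
  by rewrite -[_ *: _]/(_ * _) normrM mulrC ler_wpM2r.
exists F; split => // i; apply: Fc.
exists i.+1, (fun j => (j == i)%:R).
split; rewrite big_ord_recr/= eqxx scale1r big1 ?add0r// => j _;
  by rewrite ltn_eqF// scale0r.
Qed.

Lemma exists_dual_prescribed2 (R : realType) (Z : normedModType R) (x y : Z)
    (u v : R) : (forall a b, a * u + b * v <= `|a *: x + b *: y|) ->
  exists F : dual Z, [/\ `|F| <= 1, F x = u & F y = v].
Proof.
move=> xy.
have [||||F [F1 FP]] := @Hahn_Banach_extension R Z (fun z r => exists a b,
  z = a *: x + b *: y /\ r = a * u + b * v).
- by exists 0, 0; rewrite !scale0r !mul0r !addr0.
- move=> _ _ _ _ [a [b [-> ->]]] [a' [b' [-> ->]]]; exists (a + a'), (b + b').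
  by rewrite !scalerDl !mulrDl; split; rewrite addrACA.
- move=> c _ _ [a [b [-> ->]]]; exists (c * a), (c * b).
  by rewrite scalerDr mulrDr !scalerA !mulrA.
- by move=> _ _ [a [b [-> ->]]].
exists F; split=> //; apply: FP.
- by exists 1, 0; rewrite !scale1r !scale0r mul1r mul0r !addr0.
- by exists 0, 1; rewrite !scale1r !scale0r mul1r mul0r !add0r.
Qed.

(** * Failure of strict convexity and of smoothness in the bidual *)

Theorem corollary2p6 (R : realType) (X : completeNormedModType R)
    (X_neq0 : exists x : X, x <> 0) (X_SD2P : SD2P X) :
  ~ strictly_convex (dual (dual X)) /\ ~ smooth (dual (dual X)).
Proof.
have octX : octahedral (dual X) by exact: SD2P_octahedral.
have [f [f1 fl1]] := exists_asymptotic_l1 octX.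
pose w i : R := 1 - 2^-1 ^+ i.
have w0 i : 0 <= w i.
  by rewrite subr_ge0 exprn_ile1 ?invr_ge0// invf_le1// ler1n.
have [|F [F1 Ff]] := @exists_dual_prescribed _ _ f w w fl1.
  by move=> i; rewrite ger0_norm.
have [|G [G1 Gf]] := @exists_dual_prescribed _ _ f w (fun i => (-1) ^+ i * w i) fl1.
  by move=> i; rewrite normrM normrX normrN1 expr1n mul1r ger0_norm.
(* Evaluation at [f i], which lies in the unit ball; the parity of [i] selects [a + b] or
   [a - b]. *)
have FG a b i : w i * (a + (-1) ^+ i * b) <= `|a *: F + b *: G|.
  apply: le_trans (dual_le_norm (a *: F + b *: G) (f1 i)).
  rewrite dual_addE !dual_scaleE Ff Gf.
  by rewrite [leLHS](_ : _ = a * w i + b * ((-1) ^+ i * w i)) //; ring.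
have FGD a b : a + b <= `|a *: F + b *: G|.
  apply: le_of_half_expr => n; exists n.*2; first by rewrite -addnn leq_addr.
  have := FG a b n.*2.
  by rewrite -signr_odd odd_double expr0 mul1r.
have FGB a b : a - b <= `|a *: F + b *: G|.
  apply: le_of_half_expr => n; exists n.*2.+1.
    by rewrite leqW// -addnn leq_addr.
  have := FG a b n.*2.+1.
  by rewrite -signr_odd /= odd_double expr1 mulN1r.
have nF : `|F| = 1.
  apply/eqP; rewrite eq_le F1/=; have := FGD 1 0.
  by rewrite scale1r scale0r !addr0.
have nG : `|G| = 1.
  apply/eqP; rewrite eq_le G1/=; have := FGD 0 1.
  by rewrite scale1r scale0r !add0r.
split=> [sc|sm].
  have FneG : F <> G.
    (* Index 1 separates them, with values [1/2] and [-1/2]; at index 0 both vanish because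
       [w 0 = 0]. *)
    move=> eFG; have := Ff 1; rewrite eFG Gf expr1 mulN1r /w expr1; lra.
  have := sc _ _ nF nG FneG; rewrite normrZ ger0_norm ?invr_ge0//.
  by have := FGD 1 1; rewrite !scale1r; lra.
have norm1 (P : dual (dual (dual X))) : `|P| <= 1 -> P F = 1 -> `|P| = 1.
  move=> P1 PF; apply/eqP; rewrite eq_le P1/= -PF.
  exact: dual_le_norm.
(* [FGD] and [FGB] are exactly the domination needed for the values [(1, 1)] and [(1, -1)] at
   [(F, G)]. Both functionals norm [F], so smoothness would identify them although they differ at
   [G]. *)
have [|P [P1 PF PG]] := @exists_dual_prescribed2 _ _ F G 1 1.
  by move=> a b; rewrite !mulr1.
have [|Q [Q1 QF QG]] := @exists_dual_prescribed2 _ _ F G 1 (-1).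
  by move=> a b; rewrite mulr1 mulrN1.
have [T [_ Tuniq]] := sm F nF.
have PQ : P = Q.
  by rewrite -(Tuniq P) ?(Tuniq Q)//; split => //; exact: norm1.
by move: QG; rewrite -PQ PG; lra.
Qed.
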